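(* Let $G=U(C_l;T_1,T_2,\ldots,T_l)$ be a graph in $\mathscr{U}_{n,l}$, and let $x\in V_{T_i}$, $y\in V_{T_j}$. Then $d(x,v_i)\le d(y,v_j)$ if and only if $CC(x)\ge CC(y)$.
   Context: All graphs are finite, simple and undirected; $V_G,E_G$ are the vertex and edge sets of $G$, $d(x)$ is the degree of a vertex $x$, and $d(x,y)$ is the graph distance. A unicyclic graph is a connected graph $G$ with $|V_G|=|E_G|$ (so it has exactly one cycle). $\mathscr{U}_{n,l}$ is the set of all unicyclic graphs on $n$ vertices whose unique cycle is $C_l$ (the cycle of length $l$). Writing $G=U(C_l;T_1,\ldots,T_l)$ means that $C_l=v_1v_2\ldots v_lv_1$ is the unique cycle of $G$ and $T_i$ is the component of $G-E_{C_l}$ (the graph obtained from $G$ by deleting the edges of the cycle) containing $v_i$; each $T_i$ is a tree. The simple random walk on $G$ jumps from its current vertex $x$ to each neighbour of $x$ with probability $1/d(x)$; $H_{xy}$ is the expected value of $T_y=\inf\{k\ge 0: X_k=y\}$ for the walk $(X_k)_{k\ge0}$ started at $X_0=x$. The cover cost of $x$ is $CC(x)=\sum_{y\in V_G}H_{xy}$. *)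

(* Defs.v *)
From HB Require Import structures.
From mathcomp Require Import all_boot all_order all_algebra.
From mathcomp Require Import all_classical all_reals all_analysis.

Set Implicit Arguments.
Unset Strict Implicit.
Unset Printing Implicit Defensive.

Import Order.TTheory GRing.Theory Num.Theory.

Local Open Scope classical_set_scope.
Local Open Scope ring_scope.

(* A finite simple graph on the vertex set [T] is given by its adjacency
   relation [e : rel T]; an edge is represented by the set of its two ends. *)

Section Graphs.
Variables (T : finType) (e : rel T).

Definition simple_graph : Prop := symmetric e /\ irreflexive e.

Definition edges : {set {set T}} :=
  [set [set p.1; p.2] | p in [pred p : T * T | e p.1 p.2]]%SET.

Definition degree (x : T) : nat := #|[pred y | e x y]|.

Definition connected_graph : Prop := forall x y, connect e x y.

Definition walk_of_length (k : nat) (x y : T) : bool :=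
  [exists p : k.-tuple T, path e x p && (last x p == y)].

(* A shortest walk is duplicate-free, so its length is less than [#|T|]; the
   value is [#|T|] if there is no walk from [x] to [y]. *)
Definition dist (x y : T) : nat :=
  \big[minn/#|T|]_(k < #|T| | walk_of_length k x y) k.

Definition unicyclic : Prop :=
  [/\ simple_graph, connected_graph & #|T| = #|edges|].

(* [ucycle] alone accepts cycles of length 0 and 2. *)
Definition graph_cycle (l : nat) (c : l.-tuple T) : Prop :=
  (2 < l)%N /\ ucycle e c.

Definition unicyclic_nl (n l : nat) : Prop :=
  [/\ unicyclic, #|T| = n & exists c : l.-tuple T, graph_cycle c].

Definition cycle_edges (l : nat) (c : l.-tuple T) : {set {set T}} :=
  [set [set x; next c x] | x in c]%SET.

Definition delete_edges (F : {set {set T}}) : rel T :=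
  [rel x y | e x y && ([set x; y]%SET \notin F)].

End Graphs.

(* The vertex set of [T_i]. *)
Definition branch (T : finType) (e : rel T) (l : nat) (c : l.-tuple T)
    (i : 'I_l) : {set T} :=
  [set z | connect (delete_edges e (cycle_edges c)) (tnth c i) z]%SET.

Section RandomWalk.
Variables (R : realType) (T : finType) (e : rel T).

Definition srw_step (x y : T) : R :=
  if e x y then (degree e x)%:R^-1 else 0.

(* The law is prescribed on cylinders: conditionally on
   X_0 = s 0, ..., X_k = s k, the next vertex is s k.+1 with probability
   [srw_step (s k) (s k.+1)], written without division. *)
Record srw (x : T) := Srw {
  srw_disp : measure_display;
  srw_space : measurableType srw_disp;
  srw_prob : probability srw_space R;
  srw_pos : nat -> srw_space -> T;
  srw_measurable : forall k y, measurable (srw_pos k @^-1` [set y]);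
  srw_start : srw_prob [set w | srw_pos 0 w = x] = 1%E;
  srw_markov : forall (s : nat -> T) (k : nat),
    srw_prob [set w | forall i, (i <= k.+1)%N -> srw_pos i w = s i] =
    (srw_prob [set w | forall i, (i <= k)%N -> srw_pos i w = s i] *
     (srw_step (s k) (s k.+1))%:E)%E
}.

(* The infimum is +oo if the walk never visits [y]. *)
Definition hitting_time (x : T) (W : srw x) (y : T) (w : srw_space W) : \bar R :=
  ereal_inf [set k%:R%:E | k in [set k : nat | srw_pos k w = y]].

(* The library's expectation only covers real-valued random variables, hence
   the direct integral. *)
Definition expected_hitting_time (x : T) (W : srw x) (y : T) : \bar R :=
  (\int[srw_prob W]_w hitting_time y w)%E.

Definition cover_cost (x : T) (W : srw x) : \bar R :=
  (\sum_(y : T) expected_hitting_time W y)%E.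

End RandomWalk.

(* Main.v *)
Require Import Defs.
From mathcomp Require Import all_boot all_order all_algebra.
From mathcomp Require Import all_classical all_reals all_analysis.

From mathcomp Require Import measurable_realfun zify.

Set Implicit Arguments.
Unset Strict Implicit.
Unset Printing Implicit Defensive.

(** Write L f x for the sum of f x - f z over the neighbours z of x, and let m
    be the number of edges. One step of the walk gives L H_(.,y) x = d(x) for
    x <> y; since L f always sums to 0 and the degrees sum to 2m, the value of
    L H_(.,y) at y is d(y) - 2m. Summing over y, the cover cost satisfies
    L CC x = n d(x) - 2m, that is n (d(x) - 2) in a unicyclic graph
    ([laplacian_mean_cover]).

    Let delta x be the distance from x to the cycle. Then L delta x = 2 - d(x):
    the numbers delta x + 1 - delta z, for z a neighbour of x, are natural
    numbers; their sum over z is at least 2, because a vertex off the cycle has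
    a neighbour closer to it, and a vertex of the cycle has two neighbours on
    it; and their sum over all x and z is 2m = 2n, so that each sum over z is
    exactly 2 ([drop_eq2]). Hence CC + n delta is harmonic, so constant on a
    connected graph ([mean_cover_cycle_dist]), and a larger cover cost means a
    smaller delta. The equality [drop_eq2] also forces the only edges that join
    vertices at the same distance from the cycle to be those of the cycle
    ([level_edge]), and a vertex off the cycle to have a single neighbour closer
    to the cycle ([parent_unique]); therefore delta x = d(x, v_i) for x in T_i
    ([dist_branch]).

    On the probabilistic side, the law of the walk on cylinders determines
    P_x(T_y > k) by a recursion in k ([survivalE]), and E_x(T_y) is the sum of
    these numbers ([expected_hitting_timeE]). The sum is finite because a
    suitable function of the distance to y decreases by at least 1 on average
    at each step taken outside y ([drift_function]); this makes the above
    equations hold in the real numbers. *)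

(** * Hitting times from the law of the walk on cylinders *)

Section Survival.
Local Open Scope classical_set_scope.
Local Open Scope ring_scope.
Import Order.TTheory GRing.Theory Num.Theory.
Variables (R : realType) (T : finType) (e : rel T).

(** The probability that the walk from [x] avoids [y] at the times 0, ..., [k],
    by the recursion on the first step; see [survivalE]. *)
Fixpoint survival (y : T) (k : nat) (x : T) : R :=
  if x == y then 0
  else if k is k'.+1 then \sum_z srw_step R e x z * survival y k' z else 1.

Lemma srw_step_ge0 x z : 0 <= srw_step R e x z.
Proof. by rewrite /srw_step; case: ifP => // _; rewrite invr_ge0. Qed.

Lemma survival_ge0 y k x : 0 <= survival y k x.
Proof.
elim: k x => [|k IH] x /=; case: ifP => // _.
by apply: sumr_ge0 => z _; rewrite mulr_ge0 ?srw_step_ge0.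
Qed.

Lemma survival_target y k : survival y k y = 0.
Proof. by case: k => [|k] /=; rewrite eqxx. Qed.

Variables (x : T) (W : srw R e x).
Local Notation P := (srw_prob W).
Local Notation X := (@srw_pos _ _ _ _ W).

(** The first positions of the walk, up to time [k], are those of [s]. *)
Definition cylinder (s : nat -> T) k : set (srw_space W) :=
  [set w | forall i, (i <= k)%N -> X i w = s i].

(** The walk avoids [y] at the times [k], ..., [k + m]. *)
Definition avoids (y : T) (k m : nat) : set (srw_space W) :=
  [set w | forall j, (j <= m)%N -> X (k + j)%N w <> y].

Lemma measurable_cylinder s k : measurable (cylinder s k).
Proof.
rewrite (_ : cylinder s k =
  \bigcap_(i in [set i | (i <= k)%N]) (X i @^-1` [set s i])) //.
by apply: bigcap_measurableType => i _; apply: srw_measurable.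
Qed.

Lemma measurable_avoids y k m : measurable (avoids y k m).
Proof.
rewrite (_ : avoids y k m =
  \bigcap_(j in [set j | (j <= m)%N]) (~` (X (k + j)%N @^-1` [set y]))) //.
by apply: bigcap_measurableType => i _; apply/measurableC/srw_measurable.
Qed.


Lemma total_probability n (A : set (srw_space W)) : measurable A ->
  P A = (\sum_(z : T) P (A `&` X n @^-1` [set z]))%E.
Proof.
move=> mA.
have {1}-> : A =
    \bigcup_(z in [set` (xpredT : pred T)]) (A `&` X n @^-1` [set z]).
  by apply/seteqP; split=> w; [move=> Aw; exists (X n w) | case=> z _ []].
rewrite measure_fin_bigcup //.
- by rewrite [RHS]bigfs ?index_enum_uniq // => z _; rewrite mem_index_enum.
- by move=> u v _ _ [w [[_ /= Xu] [_ /= Xv]]]; rewrite -Xu -Xv.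
- by move=> z _; apply: measurableI => //; apply: srw_measurable.
Qed.

(** The Markov property for the avoidance of [y]: conditionally on the
    trajectory up to time [k], the walk restarts from its current position.
    Both sides vanish when that position is [y]. *)
Lemma cylinder_avoids y m s k :
  P (cylinder s k `&` avoids y k m) =
  (P (cylinder s k) * (survival y m (s k))%:E)%E.
Proof.
elim: m s k => [|m IH] s k.
  case: (eqVneq (s k) y) => [sky|sky].
    rewrite -sky survival_target mule0 (_ : _ `&` _ = set0) ?measure0 //.
    apply/seteqP; split=> w // -[Cw Aw]; case: (Aw 0%N isT).
    by rewrite addn0 Cw.
  rewrite /= (negPf sky) mule1; congr (P _).
  apply/seteqP; split=> w; first by case.
  move=> Cw; split=> // -[|//] _; rewrite addn0 (Cw k (leqnn k)).
  exact/eqP.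
case: (eqVneq (s k) y) => [sky|sky].
  rewrite -sky survival_target mule0 (_ : _ `&` _ = set0) ?measure0 //.
  apply/seteqP; split=> w // -[Cw Aw]; case: (Aw 0%N isT).
  by rewrite addn0 Cw.
rewrite (total_probability k.+1); last first.
  by apply: measurableI; [apply: measurable_cylinder|apply: measurable_avoids].
rewrite /= (negPf sky) -sumEFin ge0_sume_distrr; last first.
  by move=> z _; rewrite lee_fin mulr_ge0 ?srw_step_ge0 ?survival_ge0.
apply: eq_bigr => z _.
(* [s'] prolongs the first k + 1 positions of [s] by [z]. *)
pose s' i := if (i <= k)%N then s i else z.
have s'k : s' k = s k by rewrite /s' leqnn.
have s'k1 : s' k.+1 = z by rewrite /s' ltnn.
have -> : cylinder s k `&` avoids y k m.+1 `&` X k.+1 @^-1` [set z] =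
    cylinder s' k.+1 `&` avoids y k.+1 m.
  apply/seteqP; split=> w.
    move=> [[Cw Aw] /= Xw]; split.
      move=> i; rewrite leq_eqVlt => /predU1P[->|]; first by rewrite s'k1.
      by rewrite ltnS /s' => ik; rewrite ik Cw.
    by move=> j jm; rewrite addSnnS; apply: Aw.
  move=> [Cw Aw]; split; last by rewrite /= Cw.
  have Cw' : cylinder s k w.
    by move=> i ik; rewrite Cw ?(leqW ik) // /s' ik.
  split=> // -[_|j jm]; first by rewrite addn0 Cw' //; apply/eqP.
  by rewrite -addSnnS; apply: Aw.
rewrite IH s'k1.
have -> : P (cylinder s' k.+1) =
    (P (cylinder s k) * (srw_step R e (s k) z)%:E)%E.
  have := srw_markov W s' k; rewrite s'k s'k1 => ->; congr (P _ * _)%E.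
  by apply/seteqP; split=> w /= Cw i ik; rewrite Cw // /s' ik.
by rewrite -muleA -EFinM.
Qed.

Lemma survivalE y k : P (avoids y 0 k) = (survival y k x)%:E.
Proof.
have mC := measurable_cylinder (fun=> x) 0.
have C0 : cylinder (fun=> x) 0 = [set w | X 0%N w = x].
  by apply/seteqP; split=> w /=; [apply | move=> Xw [|//]].
have PC : P (cylinder (fun=> x) 0) = 1%E by rewrite C0 (srw_start W).
have := cylinder_avoids y k (fun=> x) 0; rewrite PC mul1e => <-.
have mA := measurable_avoids y 0 k.
rewrite setIC (measureDI P mA mC) [X in (X + _)%E](_ : _ = 0%E) ?add0e //.
apply: (@subset_measure0 _ _ _ _ _ (~` cylinder (fun=> x) 0)).
- exact: measurableD.
- exact: measurableC.
- by move=> w [].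
- by have := probability_setC P mC; rewrite PC subee.
Qed.

(** The hitting time counts the times [k] up to which [y] has been avoided; both
    sides are infinite if [y] is never reached. *)
Lemma hitting_timeE y (w : srw_space W) :
  hitting_time y w = (\sum_(k <oo) (\1_(avoids y 0 k) w)%:E)%E.
Proof.
have ind0 k : (0 <= (\1_(avoids y 0 k) w)%:E :> \bar R)%E.
  by rewrite lee_fin indicE.
case: (pselect (exists k, X k w == y)) => [hit|miss].
  case: (ex_minnP hit) => N /eqP XN minN.
  rewrite (@nneseries_split _ _ 0 N) // add0n.
  rewrite [X in (_ + X)%E]eseries0; last first.
    move=> k Nk _; rewrite indicE memNset // => /(_ N Nk); exact.
  rewrite adde0 (eq_big_nat _ _ (F2 := fun=> 1%E)); last first.
    move=> k /andP[_ kN]; rewrite indicE mem_set // => j jk /eqP Xj.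
    by have := minN _ Xj; rewrite leqNgt (leq_ltn_trans jk kN).
  rewrite sumEFin big_const_nat subn0 iter_addr addr0.
  apply/eqP; rewrite eq_le; apply/andP; split.
    by apply: ereal_inf_lbound; exists N.
  apply: le_ereal_inf_tmp => _ [k /eqP Xk <-].
  by rewrite lee_fin ler_nat minN.
rewrite /hitting_time (_ : [set k | _] = set0); last first.
  by apply/seteqP; split=> k //= Xk; apply: miss; exists k; apply/eqP.
rewrite image_set0 ereal_inf0; apply/esym/eq_infty => r.
pose N := Num.Def.archi_bound `|r|.
apply: le_trans (nneseries_lim_ge N (fun k _ _ => ind0 k)).
rewrite (eq_big_nat _ _ (F2 := fun=> 1%E)); last first.
  move=> k _; rewrite indicE mem_set // => j _ Xj.
  by apply: miss; exists j; apply/eqP.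
rewrite sumEFin big_const_nat subn0 iter_addr addr0 lee_fin.
exact: le_trans (ler_norm r) (ltW (archi_boundP (normr_ge0 r))).
Qed.

Lemma expected_hitting_timeE y :
  expected_hitting_time W y = (\sum_(k <oo) (survival y k x)%:E)%E.
Proof.
rewrite /expected_hitting_time.
under eq_integral do rewrite hitting_timeE.
rewrite integral_nneseries //.
- apply: eq_eseriesr => k _; rewrite integral_indic //; last first.
    exact: measurable_avoids.
  by rewrite setIT; apply: survivalE.
- move=> k; apply/measurable_EFinP/measurable_indic/measurable_avoids.
Qed.

End Survival.

(** * Graph distance *)

Section Distance.
Local Open Scope nat_scope.
Variables (T : finType) (e : rel T).

Lemma bigminn_le (I : finType) (M : nat) (A : pred I) (F : I -> nat) j :
  A j -> \big[minn/M]_(i | A i) F i <= F j.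
Proof.
move=> Aj; rewrite unlock; have := mem_index_enum j.
elim: (index_enum I) => [//|i s IH] /=; rewrite inE => /predU1P[<-|/IH le_s].
  by rewrite Aj geq_minl.
by case: ifP => // _; rewrite geq_min le_s orbT.
Qed.

Lemma bigminn_attained (I : finType) (M : nat) (A : pred I) (F : I -> nat) :
  \big[minn/M]_(i | A i) F i = M \/
  exists2 i, A i & \big[minn/M]_(i | A i) F i = F i.
Proof.
elim/big_rec: _ => [|i m Ai IH]; first by left.
rewrite /minn; case: ltnP => _; first by right; exists i.
by case: IH => [->|[k Ak ->]]; [left | right; exists k].
Qed.

Lemma bigminn_default (I : finType) (M : nat) (A : pred I) (F : I -> nat) :
  \big[minn/M]_(i | A i) F i <= M.
Proof.
by elim/big_rec: _ => // i m _ IH; rewrite geq_min IH orbT.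
Qed.

Lemma dist_le x p : path e x p -> dist e x (last x p) <= size p.
Proof.
move=> xp; case: (ltnP (size p) #|T|) => [lt_p|ge_p]; last first.
  exact: leq_trans (bigminn_default _ _ _) ge_p.
have /= := @bigminn_le _ #|T|
  (fun k : 'I_#|T| => walk_of_length e k x (last x p)) (@nat_of_ord _)
  (Ordinal lt_p).
by apply; apply/existsP; exists (in_tuple p); rewrite xp eqxx.
Qed.

Lemma dist_lt_card x y : connect e x y -> dist e x y < #|T|.
Proof.
case/connectP=> p xp ->; case/shortenP: xp => p' xp' Up' _.
apply: leq_ltn_trans (dist_le xp') _.
by have := max_card (mem (x :: p')); rewrite (card_uniqP Up').
Qed.

Lemma dist_path x y : connect e x y ->
  exists p, [/\ path e x p, last x p = y & size p = dist e x y].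
Proof.
move=> /dist_lt_card lt_xy.
have := @bigminn_attained 'I_#|T| #|T| (fun k => walk_of_length e k x y) val.
rewrite -/(dist e x y) => -[eq_xy|[k /existsP[p /andP[xp /eqP py]] ->]].
  by rewrite eq_xy ltnn in lt_xy.
by exists p; rewrite size_tuple.
Qed.

Lemma dist0 x : dist e x x = 0.
Proof. by apply/eqP; rewrite -leqn0 (@dist_le x [::]). Qed.

Hypothesis conn : connected_graph e.

Lemma dist_step x z y : e x z -> dist e x y <= (dist e z y).+1.
Proof.
move=> xz; have [p [zp <- <-]] := dist_path (conn z y).
by have := @dist_le x (z :: p); rewrite /= xz; apply.
Qed.

Lemma dist_neighbour x y : x != y ->
  exists2 z, e x z & dist e x y = (dist e z y).+1.
Proof.
have [[|z p] [/= + yE sz]] := dist_path (conn x y); first by rewrite yE eqxx.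
case/andP=> xz zp _; exists z => //; apply/eqP; rewrite eqn_leq dist_step //.
by rewrite -sz -yE /= ltnS dist_le.
Qed.

(** The distance from a vertex to a set of vertices; it is meant for a nonempty
    set, the value being [#|T|] for the empty one. *)
Definition dist_to (A : {pred T}) (x : T) : nat :=
  \big[minn/#|T|]_(v in A) dist e x v.

Variable A : {pred T}.

Lemma dist_to_le x v : v \in A -> dist_to A x <= dist e x v.
Proof. by move=> Av; apply: bigminn_le. Qed.

Lemma dist_to_mem x : x \in A -> dist_to A x = 0.
Proof.
by move=> Ax; apply/eqP; rewrite -leqn0 -[X in _ <= X](dist0 x) dist_to_le.
Qed.

Variable a : T.
Hypothesis Aa : a \in A.

Lemma dist_to_attained x : exists2 v, v \in A & dist_to A x = dist e x v.
Proof.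
rewrite /dist_to.
have [eqT|[v Av ->]] := @bigminn_attained T #|T| (fun v => v \in A) (dist e x);
  last by exists v.
have := dist_lt_card (conn x a).
by rewrite ltnNge -[X in X <= _]eqT dist_to_le.
Qed.

Lemma dist_to_step x z : e x z -> dist_to A x <= (dist_to A z).+1.
Proof.
move=> xz; have [v Av ->] := dist_to_attained z.
exact: leq_trans (dist_to_le x Av) (dist_step _ xz).
Qed.

Lemma dist_to_neighbour x : x \notin A ->
  exists2 z, e x z & dist_to A x = (dist_to A z).+1.
Proof.
move=> Ax; have [v Av xv] := dist_to_attained x.
have [|z xz vz] := @dist_neighbour x v.
  by apply: contraNneq Ax => ->.
exists z => //; apply/eqP; rewrite eqn_leq dist_to_step //.
by rewrite xv vz ltnS dist_to_le.
Qed.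

End Distance.

(** * Degrees and ordered edges *)

Section Degrees.
Local Open Scope nat_scope.
Variables (T : finType) (e : rel T).

Lemma set2_eqP (a b u v : T) :
  ([set u; v]%SET == [set a; b]%SET) =
  ((u, v) == (a, b)) || ((u, v) == (b, a)).
Proof.
apply/eqP/orP => [uv|[] /eqP[-> ->] //]; last by rewrite finset.setUC.
have := set21 u v; have := set22 u v; rewrite uv !inE.
have := set21 a b; have := set22 a b; rewrite -uv !inE.
rewrite !xpair_eqE ![a == _]eq_sym ![b == _]eq_sym.
by case: (u == a); case: (v == b); case: (u == b); case: (v == a) => //=; auto.
Qed.

Hypothesis graph : simple_graph e.

(** The handshake lemma. *)
Lemma degree_sum : \sum_x degree e x = 2 * #|edges e|.
Proof.
have [sym irr] := graph.
have -> : \sum_x degree e x = \sum_(p in [pred p : T * T | e p.1 p.2]) 1.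
  transitivity (\sum_x \sum_(y | e x y) 1).
    by apply: eq_bigr => x _; rewrite /degree -sum1_card.
  by rewrite pair_big_dep.
rewrite (partition_big_imset (fun p : T * T => [set p.1; p.2]%SET)) /=.
rewrite mulnC -sum_nat_const; apply: eq_bigr => F /imsetP[[a b]].
rewrite inE /= => ab ->.
rewrite (eq_bigl (mem [set (a, b); (b, a)]%SET)) => [|[u v]]; last first.
  rewrite !inE /= set2_eqP andb_idl // => /orP[] /eqP[-> ->] //.
  by rewrite sym.
rewrite sum1_card cards2 xpair_eqE; case: eqVneq ab => // ->.
by rewrite irr.
Qed.

(** If a function changes by at most one along each edge, then the numbers
    f x + 1 - f z, summed over the ordered edges, count these edges: the two
    orientations of an edge contribute 2 together. *)
Lemma drop_sum (f : T -> nat) :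
  (forall x z, e x z -> f x <= (f z).+1) ->
  \sum_x \sum_(z | e x z) ((f x).+1 - f z) = 2 * #|edges e|.
Proof.
have [sym irr] := graph => f1.
apply/eqP; rewrite -(eqn_pmul2l (m := 2)) // -degree_sum; apply/eqP.
rewrite mul2n -addnn [X in X + _ = _]pair_big_dep /=.
rewrite [X in _ + X](exchange_big_dep xpredT) //=.
rewrite [X in _ + X]pair_big_dep /=.
rewrite [X in _ + X](eq_bigl (fun p : T * T => e p.1 p.2)); last first.
  by move=> p /=; rewrite sym.
rewrite -big_split /= (eq_bigr (fun=> 2)) => [|[u v] /= uv]; last first.
  have := f1 _ _ uv; rewrite sym in uv; have := f1 _ _ uv; lia.
rewrite -(pair_big_dep xpredT e (fun _ _ => 2)) big_distrr /=.
by apply: eq_bigr => x _; rewrite sum_nat_const mulnC.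
Qed.

Lemma sum_uniq_le (s : seq T) (A : pred T) (F : T -> nat) :
  uniq s -> all A s -> \sum_(z <- s) F z <= \sum_(z | A z) F z.
Proof.
move=> Us /allP As; rewrite big_uniq //= [leqRHS](bigID (mem s)) /=.
rewrite [X in _ <= X + _](eq_bigl (mem s)) ?leq_addr // => z /=.
by apply: andb_idl => /As.
Qed.
End Degrees.

(** * Distance to the cycle of a unicyclic graph *)

Section Unicyclic.
Local Open Scope nat_scope.
Variables (T : finType) (e : rel T).
Hypothesis uni : unicyclic e.
Variables (l : nat) (c : l.-tuple T).
Hypothesis cyc : graph_cycle e c.

(** The distance from a vertex to the cycle. *)
Definition cycle_dist (x : T) : nat := dist_to e [in c] x.

Local Notation delta := cycle_dist.

Let conn : connected_graph e. Proof. by case: uni. Qed.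
Let sym : symmetric e. Proof. by case: uni => -[]. Qed.
Let Uc : uniq c. Proof. by case: cyc => _ /andP[]. Qed.

Lemma cycle_nonempty : exists a, a \in [in c].
Proof.
have [l3 _] := cyc; have l0 : 0 < l by exact: leq_trans l3.
by exists (tnth c (Ordinal l0)); exact: mem_tnth.
Qed.

Lemma cycle_dist0 x : x \in c -> delta x = 0.
Proof. by move=> cx; apply: dist_to_mem. Qed.

Let delta_step x z : e x z -> delta x <= (delta z).+1.
Proof. by have [a ca] := cycle_nonempty; apply: (dist_to_step conn ca). Qed.

Let delta_neighbour x : x \notin c ->
  exists2 z, e x z & delta x = (delta z).+1.
Proof.
by have [a ca] := cycle_nonempty; apply: (dist_to_neighbour conn ca).
Qed.

Lemma next_neq_prev x : x \in c -> next c x != prev c x.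
Proof.
move=> cx; apply/eqP => np.
have nn : next c (next c x) = x by rewrite np next_prev.
have [i s rot_c] := rot_to cx.
have [l3 _] := cyc; move: nn; rewrite -!(next_rot i Uc) rot_c.
have : uniq (x :: s) by rewrite -rot_c rot_uniq.
have : 2 < size (x :: s) by rewrite -rot_c size_rot size_tuple.
case: s {rot_c} => [|a [|b s]] //= _; rewrite !inE !negb_or.
case/and3P=> /and3P[xa xb _] /andP[ab _] _.
rewrite eqxx [a == x]eq_sym (negPf xa) /= eqxx => bx; by rewrite bx eqxx in xb.
Qed.

Lemma cycle_neighbours x : x \in c ->
  [/\ e x (next c x), e x (prev c x),
      delta (next c x) = 0 & delta (prev c x) = 0].
Proof.
move=> cx; have [_ /andP[ec _]] := cyc.
rewrite [e x (prev c x)]sym (prev_cycle ec cx) (next_cycle ec cx).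
by rewrite !cycle_dist0 ?mem_next ?mem_prev.
Qed.

(** A neighbour one step closer to the cycle contributes 2; on the cycle, the
    two neighbours along the cycle contribute 1 each. *)
Lemma drop_ge2 x : 2 <= \sum_(z | e x z) ((delta x).+1 - delta z).
Proof.
case: (boolP (x \in c)) => [cx|ncx].
  have [xn xp n0 p0] := cycle_neighbours cx.
  have := @sum_uniq_le _ [:: next c x; prev c x] (e x)
    (fun z => (delta x).+1 - delta z).
  rewrite /= inE next_neq_prev // xn xp => /(_ isT isT); apply: leq_trans.
  by rewrite !big_cons big_nil n0 p0; lia.
have [z xz dz] := delta_neighbour ncx.
rewrite (bigD1 z xz) /= dz; apply: leq_trans (leq_addr _ _); lia.
Qed.

(** The lower bounds [drop_ge2] add up to 2 #|T| = 2 #|edges e|, which is the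
    value of the total sum; hence each of them is an equality. *)
Lemma drop_eq2 x : \sum_(z | e x z) ((delta x).+1 - delta z) = 2.
Proof.
have [graph _ card_TE] := uni.
have tot := drop_sum graph delta_step.
have [_] := leqif_sum (P := xpredT) (fun x _ => leqif_eq (drop_ge2 x)).
rewrite tot sum_nat_const -card_TE mulnC eqxx => /esym/forall_inP/(_ x isT).
by move/eqP.
Qed.

Lemma drop_le2 x s : uniq s -> all (e x) s ->
  \sum_(z <- s) ((delta x).+1 - delta z) <= 2.
Proof. by move=> Us As; rewrite -(drop_eq2 x) sum_uniq_le. Qed.

Lemma parent_unique x z z' : e x z -> e x z' ->
  delta x = (delta z).+1 -> delta x = (delta z').+1 -> z = z'.
Proof.
move=> xz xz' dz dz'; apply/eqP; apply: contraTT isT => zz'.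
have := @drop_le2 x [:: z; z']; rewrite /= inE zz' xz xz' => /(_ isT isT).
by rewrite !big_cons big_nil; lia.
Qed.

Lemma level_edge x z : e x z -> delta x = delta z ->
  x \in c /\ (z = next c x \/ z = prev c x).
Proof.
move=> xz dxz; case: (boolP (x \in c)) => [cx|ncx].
  split=> //; have [xn xp n0 p0] := cycle_neighbours cx.
  case: (eqVneq z (next c x)) => [|zn]; first by left.
  case: (eqVneq z (prev c x)) => [|zp]; first by right.
  have := @drop_le2 x [:: z; next c x; prev c x].
  rewrite /= !inE negb_or zn zp next_neq_prev // xz xn xp => /(_ isT isT).
  by rewrite !big_cons big_nil; lia.
have [y xy dy] := delta_neighbour ncx.
have := @drop_le2 x [:: z; y]; rewrite /= inE xz xy => /(_ _ isT).
rewrite !big_cons big_nil.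
case: eqVneq => [zy|_ /(_ isT)]; last lia.
by rewrite -zy in dy; lia.
Qed.

(** By induction on a path from [tnth c i] that avoids the edges of the cycle.
    Along a step [u] to [w] of this path, [cycle_dist] changes by exactly one;
    if it decreases, [w] is the only neighbour of [u] closer to the cycle, hence
    it is also the first vertex on a shortest walk from [u] to [tnth c i]. *)
Lemma dist_branch i x : x \in branch e c i -> dist e x (tnth c i) = delta x.
Proof.
rewrite inE => /connectP[p + ->] {x}; set v := tnth c i.
have delta_le z : delta z <= dist e z v by apply: dist_to_le; apply: mem_tnth.
move=> vp; apply/eqP; rewrite eqn_leq delta_le andbT.
elim/last_ind: p vp => [|p w IH]; first by rewrite /= dist0.
rewrite rcons_path last_rcons => /andP[/IH]; move: (last v p) => u {IH}.
move=> du /andP[uw cut]; have wu : e w u by rewrite sym.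
case: (ltngtP (delta u) (delta w)) => [lt_uw|lt_wu|eq_uw].
- have := dist_step conn v wu; have := delta_step wu; lia.
- have du1 : delta u = (delta w).+1 by have := delta_step uw; lia.
  have [|z uz dz] := @dist_neighbour _ _ conn u v.
    by apply: contra_eqN du1 => /eqP->; rewrite cycle_dist0 ?mem_tnth.
  have zd := delta_le z.
  have dz1 : delta u = (delta z).+1 by have := delta_step uz; lia.
  by rewrite (parent_unique uw uz du1 dz1); lia.
- have [cu wE] := level_edge uw eq_uw.
  case/negP: cut; apply/imsetP; case: wE => ->; first by exists u.
  by exists (prev c u); rewrite ?mem_prev // next_prev // finset.setUC.
Qed.

End Unicyclic.

(** * The Laplacian *)

Section Laplacian.
Local Open Scope ring_scope.
Import Order.TTheory GRing.Theory Num.Theory.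
Variables (R : realFieldType) (T : finType) (e : rel T).

(** The unnormalized Laplacian of the graph. *)
Definition laplacian (f : T -> R) (x : T) : R := \sum_(z | e x z) (f x - f z).

Lemma laplacianE f x :
  laplacian f x = (degree e x)%:R * f x - \sum_(z | e x z) f z.
Proof.
rewrite /laplacian sumrB sumr_const -[f x *+ _]mulr_natl.
by congr (_%:R * _ - _); apply: eq_card.
Qed.

Lemma sum_laplacian f : symmetric e -> \sum_x laplacian f x = 0.
Proof.
move=> sym; rewrite (eq_bigr _ (fun x _ => sumrB _ _ _ _)) sumrB.
rewrite (exchange_big_dep xpredT) //=; apply/eqP; rewrite subr_eq0; apply/eqP.
by apply: eq_bigr => x _; apply: eq_bigl => z; rewrite sym.
Qed.

(** The maximum principle: the set where [f] is maximal is closed under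
    adjacency. *)
Lemma harmonic_constant f : connected_graph e ->
  (forall x, laplacian f x = 0) -> forall x y, f x = f y.
Proof.
move=> conn f0 x y.
pose m := [arg max_(u > x) f u]%O.
have m_max u : f u <= f m by rewrite /m; case: arg_maxP => // v _; apply.
suff f_m u : f u = f m by rewrite !f_m.
have /connectP[p mp ->] := conn m u.
elim/last_ind: p mp => [//|p w IH]; rewrite rcons_path last_rcons.
case/andP=> /IH; move: (last m p) => v fv vw; apply/esym/eqP.
rewrite -subr_eq0 -fv; apply/eqP.
apply: (psumr_eq0P (P := e v) (F := fun z => f v - f z)) => // [z _|].
  by rewrite fv subr_ge0.
exact: f0.
Qed.

End Laplacian.

(** * Mean hitting times and the Laplacian of the cover cost *)

Section HittingTimes.
Local Open Scope ring_scope.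
Import Order.TTheory GRing.Theory Num.Theory.
Variables (R : realType) (T : finType) (e : rel T).
Hypotheses (graph : simple_graph e) (conn : connected_graph e).

Lemma degree_gt0 x z : e x z -> (0 < degree e x)%N.
Proof. by move=> xz; apply/card_gt0P; exists z. Qed.

Lemma srw_step_mean (f : T -> R) x :
  \sum_z srw_step R e x z * f z = (degree e x)%:R^-1 * \sum_(z | e x z) f z.
Proof.
rewrite big_distrr [RHS]big_mkcond /=; apply: eq_bigr => z _.
by rewrite /srw_step; case: ifP; rewrite ?mul0r.
Qed.

(** A concave increasing function of the distance to [y], with increments
    growing by the factor [#|T|] towards [y]: the one step closer to [y] that
    some neighbour of [x] offers outweighs all the steps away from [y]. The
    inequality is the mean decrease by 1 at [x], multiplied by the degree
    of [x]. *)
Lemma drift_function y : exists h : T -> nat, forall x, x != y ->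
  (degree e x + \sum_(z | e x z) h z <= degree e x * h x)%N.
Proof.
(* [w k] is the increment from distance k to k + 1; the exponents stay positive,
   as distances are less than [#|T|]. *)
pose N := #|T|; pose w k := (N ^ (N - k))%N.
pose g d := (\sum_(k < d) w k)%N; exists (fun x => g (dist e x y)) => x xy.
have [z0 xz0 dz0] := dist_neighbour conn xy.
set d := dist e z0 y in dz0.
have d1N : (d.+1 < N)%N by rewrite -dz0 dist_lt_card.
have degN : (degree e x <= N)%N by exact: max_card.
have gS k : g k.+1 = (g k + w k)%N by rewrite /g big_ord_recr.
have wS : w d = (N * w d.+1)%N by rewrite /w -expnS -subSn // ltnW.
have wN : (N <= w d.+1)%N.
  by rewrite -[leqLHS]expn1 leq_pexp2l ?subn_gt0 // (leq_ltn_trans _ d1N).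
have g_nbr z : e x z -> (g (dist e z y) <= g d.+2)%N.
  have [sym _] := graph; rewrite sym => zx.
  have := dist_step conn y zx; rewrite dz0 => /subnK <-.
  elim: (d.+2 - _)%N => [//|k IH].
  by rewrite addSn gS; apply: leq_trans IH (leq_addr _ _).
rewrite dz0 (bigD1 z0 xz0) /= -/d.
have cardE : (#|[pred z | e x z && (z != z0)]| = (degree e x).-1)%N.
  rewrite /degree [in RHS](cardD1 z0) inE xz0 /=; apply: eq_card => z.
  by rewrite !inE andbC.
have : (\sum_(z | e x z && (z != z0)) g (dist e z y) <=
    (degree e x).-1 * g d.+2)%N.
  rewrite -cardE -sum_nat_const; apply: leq_sum => z /andP[xz _]; exact: g_nbr.
rewrite !gS wS; have := degree_gt0 xz0.
case: (degree e x) degN => [//|D] /= degN _.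
move: (\sum_(z | _) _)%N => S le_S.
move: (w d.+1) wN le_S => v wN le_S.
have Dv : (D.+1 * v <= N * v)%N by rewrite leq_mul2r degN orbT.
nia.
Qed.

(** The mean of the hitting time of [y] from [x], in terms of [survival] only,
    so that it does not depend on the space where the walk is realized. *)
Definition mean_hitting_time (y x : T) : \bar R :=
  (\sum_(k <oo) (survival R e y k x)%:E)%E.

Lemma survival0 y x : x != y -> survival R e y 0 x = 1.
Proof. by move=> /negPf xy; rewrite /= xy. Qed.

Lemma survivalS y k x : x != y ->
  survival R e y k.+1 x = \sum_z srw_step R e x z * survival R e y k z.
Proof. by move=> /negPf xy; rewrite /= xy. Qed.

Let survival_ge0E y k x : (0 <= (survival R e y k x)%:E :> \bar R)%E.
Proof. by rewrite lee_fin survival_ge0. Qed.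

Lemma first_step y x : x != y -> mean_hitting_time y x =
  (1 + \sum_z (srw_step R e x z)%:E * mean_hitting_time y z)%E.
Proof.
move=> xy; rewrite /mean_hitting_time nneseries_recl // survival0 //.
congr (_ + _)%E; rewrite -nneseries_addn //.
under eq_eseriesr => k _.
  rewrite addn1 survivalS // -sumEFin.
  under eq_bigr => z _ do rewrite EFinM.
  over.
rewrite nneseries_sum => [|z k _]; last first.
  by rewrite mule_ge0 // lee_fin srw_step_ge0.
by apply: eq_bigr => z _; rewrite nneseriesZl.
Qed.

(** A nonnegative function that decreases by at least 1 on average at each step
    taken outside [y] bounds the mean hitting time of [y]. *)
Lemma survival_sum_le y (h : T -> R) : (forall x, 0 <= h x) ->
  (forall x, x != y -> 1 + \sum_z srw_step R e x z * h z <= h x) ->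
  forall N x, \sum_(k < N) survival R e y k x <= h x.
Proof.
move=> h0 hdrift; elim=> [|N IH] x; first by rewrite big_ord0.
case: (eqVneq x y) => [->|xy].
  by rewrite big1 // => k _; rewrite survival_target.
rewrite big_ord_recl survival0 //; apply: le_trans (hdrift x xy).
rewrite lerD2l; under eq_bigr => k _ do rewrite lift0 survivalS //.
rewrite exchange_big; apply: ler_sum => z _; rewrite -mulr_sumr.
by rewrite ler_wpM2l ?srw_step_ge0.
Qed.

Lemma mean_hitting_time_fin y x : mean_hitting_time y x \is a fin_num.
Proof.
have [h hdrift] := drift_function y.
have bound N u : \sum_(k < N) survival R e y k u <= (h u)%:R.
  apply: (survival_sum_le (h := fun u => (h u)%:R)) => // v vy.
  have [z vz _] := dist_neighbour conn vy; have deg0 := degree_gt0 vz.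
  rewrite srw_step_mean -(ler_pM2l (x := (degree e v)%:R)) ?ltr0n //.
  rewrite mulrDr mulr1 mulVKf ?pnatr_eq0 -?lt0n //.
  by rewrite -natr_sum -natrD -natrM ler_nat hdrift.
rewrite ge0_fin_numE; last by apply: nneseries_ge0.
apply: (@le_lt_trans _ _ (h x)%:R%:E); last exact: ltry.
apply: lime_le; first exact: is_cvg_nneseries.
by apply: nearW => N; rewrite sumEFin big_mkord lee_fin.
Qed.

(** The mean hitting time as a real number. *)
Definition mean_hit (y x : T) : R := fine (mean_hitting_time y x).

Lemma mean_hitE y x : mean_hitting_time y x = (mean_hit y x)%:E.
Proof. by rewrite /mean_hit fineK ?mean_hitting_time_fin. Qed.

Lemma laplacian_mean_hit_neq y x : x != y ->
  laplacian e (mean_hit y) x = (degree e x)%:R.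
Proof.
move=> xy; have [z xz _] := dist_neighbour conn xy; have deg0 := degree_gt0 xz.
have : mean_hit y x = 1 + (degree e x)%:R^-1 * \sum_(z | e x z) mean_hit y z.
  apply: EFin_inj.
  rewrite -srw_step_mean EFinD -sumEFin -mean_hitE first_step //.
  by congr (_ + _)%E; apply: eq_bigr => u _; rewrite mean_hitE EFinM.
rewrite laplacianE => ->; rewrite mulrDr mulr1 mulVKf ?addrK //.
by rewrite pnatr_eq0 -lt0n.
Qed.

(** At [y] itself, the value follows from [sum_laplacian] and [degree_sum]. *)
Lemma laplacian_mean_hit y x : laplacian e (mean_hit y) x =
  (degree e x)%:R - (x == y)%:R * (2 * #|edges e|)%:R.
Proof.
case: eqVneq => [->|xy]; last by rewrite mul0r subr0 laplacian_mean_hit_neq.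
have [sym _] := graph.
have := sum_laplacian (mean_hit y) sym; rewrite (bigD1 y) //=.
rewrite (eq_bigr _ (fun u => @laplacian_mean_hit_neq y u)) -natr_sum => /eqP.
rewrite addr_eq0 => /eqP->; rewrite mul1r -(degree_sum graph).
by rewrite [in RHS](bigD1 y) //= natrD opprD addrA subrr add0r.
Qed.

(** The cover cost as a real number. *)
Definition mean_cover (x : T) : R := \sum_y mean_hit y x.

Lemma laplacian_mean_cover x : laplacian e mean_cover x =
  #|T|%:R * (degree e x)%:R - (2 * #|edges e|)%:R.
Proof.
transitivity (\sum_y laplacian e (mean_hit y) x).
  by rewrite exchange_big; apply: eq_bigr => z _; rewrite -sumrB.
under eq_bigr => y _ do rewrite laplacian_mean_hit.
rewrite sumrB sumr_const; congr (_ - _); first by rewrite -[LHS]mulr_natl.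
rewrite (bigD1 x) //= eqxx mul1r big1 ?addr0 // => y yx.
by rewrite eq_sym (negPf yx) mul0r.
Qed.

Lemma cover_costE x (W : srw R e x) : cover_cost W = (mean_cover x)%:E.
Proof.
rewrite /cover_cost /mean_cover -sumEFin; apply: eq_bigr => y _.
by rewrite -mean_hitE expected_hitting_timeE.
Qed.

End HittingTimes.

(** * Cover cost and distance to the cycle *)

Section CoverCost.
Local Open Scope ring_scope.
Import Order.TTheory GRing.Theory Num.Theory.
Variables (R : realType) (T : finType) (e : rel T).
Hypothesis uni : unicyclic e.
Variables (l : nat) (c : l.-tuple T).
Hypothesis cyc : graph_cycle e c.

Lemma laplacian_cycle_dist x :
  laplacian e (fun z => (cycle_dist e c z)%:R) x = 2 - (degree e x)%:R :> R.
Proof.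
have := drop_eq2 uni cyc x; move/(congr1 (fun k => k%:R : R)) => <-.
rewrite natr_sum; apply/eqP; rewrite eq_sym subr_eq; apply/eqP.
rewrite /laplacian /degree -sum1_card natr_sum -big_split /=.
apply: eq_bigr => z xz; rewrite natrB; last first.
  have [graph conn _] := uni; have [sym _] := graph.
  have [a ca] := cycle_nonempty cyc.
  by rewrite sym in xz; apply: (dist_to_step conn ca).
by rewrite -addn1 natrD addrAC.
Qed.

Lemma mean_cover_cycle_dist x y :
  mean_cover R e x + #|T|%:R * (cycle_dist e c x)%:R =
  mean_cover R e y + #|T|%:R * (cycle_dist e c y)%:R.
Proof.
have [graph conn card_TE] := uni.
pose f z := mean_cover R e z + #|T|%:R * (cycle_dist e c z)%:R.
apply: (harmonic_constant (f := f) conn) => {x y} x.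
transitivity (laplacian e (mean_cover R e) x +
    #|T|%:R * laplacian e (fun z => (cycle_dist e c z)%:R) x).
  rewrite /laplacian mulr_sumr -big_split /=; apply: eq_bigr => z _.
  by rewrite /f mulrBr opprD addrACA.
rewrite laplacian_mean_cover // laplacian_cycle_dist -card_TE natrM mulrBr.
by rewrite [2 * _]mulrC addrA subrK subrr.
Qed.

Lemma mean_cover_le x y : (mean_cover R e y <= mean_cover R e x) =
  (cycle_dist e c x <= cycle_dist e c y)%N.
Proof.
have T0 : 0 < #|T|%:R :> R by rewrite ltr0n; apply/card_gt0P; exists x.
rewrite -(ler_nat R) -(ler_pM2l T0) -[RHS](lerD2l (mean_cover R e x)).
by rewrite (mean_cover_cycle_dist x y) lerD2r.
Qed.

End CoverCost.

Theorem corollary1p2 (R : realType) (T : finType) (e : rel T) (n l : nat)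
    (hG : unicyclic_nl e n l)
    (c : l.-tuple T) (hc : graph_cycle e c)
    (W : forall z : T, srw R e z)
    (i j : 'I_l) (x y : T)
    (hx : x \in branch e c i) (hy : y \in branch e c j) :
  (dist e x (tnth c i) <= dist e y (tnth c j))%N <->
  (cover_cost (W y) <= cover_cost (W x))%E.
Proof.
have [uni _ _] := hG; have [graph conn _] := uni.
rewrite (dist_branch uni hc hx) (dist_branch uni hc hy) !cover_costE // lee_fin.
by rewrite (mean_cover_le R uni hc).
Qed.
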